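(* Consider the parameterized family of continuous-time Markov decision processes described in the context, with fixed baseline parameter $\theta\in\Theta$. Suppose that for all $\tilde\theta\in\Theta$, $s,s'\in\mathcal S$ and $a\in\mathcal A_s$, $\lambda^a_{ss',\theta}>0$ if and only if $\lambda^a_{ss',\tilde\theta}>0$. Then for all $\tau>0$, $\pi\in\Pi$ and $\varepsilon\ge0$, $$\inf_{\tilde\theta\in\mathcal C^\pi_{\tau,\varepsilon}(\theta)}\mathbb E_\rho^{\mathbb P^\pi_{\tilde\theta}}\Big[\int_0^\infty e^{-rt}\sum_{a\in\mathcal A_{S_t}}\pi(a|S_t)R_{\tilde\theta}(S_t,a)\,\mathrm dt\Big]$$ $$\ge\ \exp\Big(\mathbb E_\rho^{\mathbb P^\pi_\theta}\Big[\int_0^\infty e^{-rt}\Big(\sum_{a\in\mathcal A_{S_t}}\pi(a|S_t)\,\big(r\log R_\theta(S_t,a)\big)-\tau\,\mathrm{KL}(\pi\|\mu)(S_t)\Big)\mathrm dt\Big]-\frac{\varepsilon}{r}-\log r\Big),$$ where $$\mathcal C^\pi_{\tau,\varepsilon}(\theta):=\Big\{\tilde\theta\in\Theta\ \Big|\ \sum_{s\in\mathcal S}\bar{\mathrm d}^\pi_{\rho,\theta}(s)\,\tau\log\Big[\sum_{a\in\mathcal A_s}\mu(a|s)\exp\Big(\frac{c_{\theta,\tilde\theta}(s,a)}{\tau}\Big)\Big]\le\varepsilon\Big\},$$ $$c_{\theta,\tilde\theta}(s,a):=\ell(\lambda^a_\theta,\lambda^a_{\tilde\theta})(s)-r\log\frac{R_{\tilde\theta}(s,a)}{R_\theta(s,a)},\qquad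 \ell(\lambda^a_\theta,\lambda^a_{\tilde\theta})(s):=\sum_{s'\ne s}\Big[\lambda^a_{ss',\theta}\log\frac{\lambda^a_{ss',\theta}}{\lambda^a_{ss',\tilde\theta}}-(\lambda^a_{ss',\theta}-\lambda^a_{ss',\tilde\theta})\Big].$$
   Context: $\mathcal S$ and $\mathcal A$ are finite state and action spaces; for each $s\in\mathcal S$, $\mathcal A_s\subseteq\mathcal A$ is a nonempty set of available actions. $\Theta$ is a parameter set. For each $\vartheta\in\Theta$, $s\in\mathcal S$, $a\in\mathcal A_s$ there are transition rates $\lambda^a_{ss',\vartheta}\ge 0$ for $s'\ne s$, with $\lambda^a_{ss,\vartheta}=-\sum_{s'\neq s}\lambda^a_{ss',\vartheta}$, and a reward function $R_\vartheta:\mathcal S\times\mathcal A\to(0,\infty)$. A baseline $\theta\in\Theta$ is fixed. The policy class is $\Pi:=\{\pi:\mathcal S\to\mathcal P(\mathcal A)\mid \sum_{a\in\mathcal A_s}\pi(a|s)=1\ \forall s\in\mathcal S\}$, where $\mathcal P(\cdot)$ denotes probability measures. Fix an initial distribution $\rho\in\mathcal P(\mathcal S)$ and a discount rate $r>0$. For $\pi\in\Pi$ and $\vartheta\in\Theta$, $\mathbb P^\pi_\vartheta$ is the law of the continuous-time Markov chain $(S_t)_{t\ge0}$ on $\mathcal S$ with initial distribution $\rho$ and generator $\lambda^\pi_{ss',\vartheta}:=\sum_{a\in\mathcal A_s}\pi(a|s)\lambda^a_{ss',\vartheta}$; $\mathbb E_\rho^{\mathbb P^\pi_\vartheta}$ is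 the corresponding expectation. The reference policy $\mu:\mathcal S\to\mathcal P(\mathcal A)$ satisfies $\operatorname{supp}\mu(\cdot|s)=\mathcal A_s$ for all $s$, and $\mathrm{KL}(\pi\|\mu)(s):=\sum_{a\in\mathcal A_s}\pi(a|s)\log\frac{\pi(a|s)}{\mu(a|s)}$ with the convention $0\log(0/x)=0$; the same convention (including $0\log(0/0)=0$) is used in $\ell$. The normalized discounted state occupancy measure is $\bar{\mathrm d}^\pi_{\rho,\vartheta}(s):=r\,\mathbb E_\rho^{\mathbb P^\pi_\vartheta}\big[\int_0^\infty e^{-rt}\mathbf 1_{\{S_t=s\}}\,\mathrm dt\big]$, $s\in\mathcal S$. The infimum over the empty set is $+\infty$. *)

(* Defs.v *)
From mathcomp Require Import all_boot all_order all_algebra.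
From mathcomp Require Import all_classical all_reals all_analysis.

Set Implicit Arguments.
Unset Strict Implicit.
Unset Printing Implicit Defensive.

Import Order.TTheory GRing.Theory Num.Theory.
Import numFieldNormedType.Exports.

Local Open Scope classical_set_scope.
Local Open Scope ring_scope.

Definition is_distr (R : realType) (T : finType) (p : T -> R) : Prop :=
  (forall x, 0 <= p x) /\ \sum_x p x = 1.

(** * Continuous-time Markov chains on a finite state space *)

Section markov_chains.
Context {R : realType} {S : finType}.

(* The transition probabilities [p t s s'] form a stochastic semigroup whose
   infinitesimal generator is [Q]; only times [t >= 0] matter. *)
Definition transition_semigroup (Q : S -> S -> R) (p : R -> S -> S -> R) :
    Prop :=
  [/\ forall t s, 0 <= t -> is_distr (p t s),
      forall s s', p 0 s s' = (s == s')%:R,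
      forall t u s s', 0 <= t -> 0 <= u ->
        p (t + u) s s' = \sum_x p t s x * p u x s' &
      forall s s', h^-1 * (p h s s' - (s == s')%:R) @[h --> 0^'+] --> Q s s'].

(* [X] is, under [P], a right-continuous Markov chain with initial distribution
   [rho] and generator [Q].  The last clause gives the finite-dimensional
   distributions; as [S] is discrete, right-continuity of a path means that it
   is locally constant to the right. *)
Definition markov_chain d (Omega : measurableType d) (P : probability Omega R)
    (X : R -> Omega -> S) (rho : S -> R) (Q : S -> S -> R) : Prop :=
  [/\ forall t s, 0 <= t -> measurable [set w | X t w = s],
      forall w t, 0 <= t -> \forall u \near t^'+, X u w = X t w &
      exists2 p, transition_semigroup Q p &
        forall (n : nat) (t : nat -> R) (x : nat -> S),
          t 0%N = 0 -> (forall k, t k <= t k.+1) ->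
          P [set w | forall k, (k <= n)%N -> X (t k) w = x k] =
          (rho (x 0%N) *
           \prod_(k < n) p (t k.+1 - t k) (x k) (x k.+1))%:E].

Definition discounted_integral {Omega : Type} (r : R) (X : R -> Omega -> S)
    (f : S -> R) (w : Omega) : R :=
  (\int[lebesgue_measure]_(t in `[0, +oo[) (expR (- (r * t)) * f (X t w)))%R.

Definition discounted_expectation d (Omega : measurableType d)
    (P : probability Omega R) (r : R) (X : R -> Omega -> S) (f : S -> R) :
    \bar R :=
  'E_P[discounted_integral r X f].

(* The expectation is finite (bounded integrand), so [fine] loses nothing. *)
Definition occupancy d (Omega : measurableType d) (P : probability Omega R)
    (r : R) (X : R -> Omega -> S) (s : S) : R :=
  r * fine (discounted_expectation P r X (fun s' => (s' == s)%:R)).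

End markov_chains.

(** * Parameterized continuous-time Markov decision processes *)

(* [rate vartheta a s s'] is meaningful only for [a \in avail s]. *)
Record ctmdp (R : realType) (S A : finType) (Theta : Type) := CTMDP {
  avail : S -> {set A};
  rate : Theta -> A -> S -> S -> R;
  reward : Theta -> S -> A -> R;
  avail_neq0 : forall s, avail s != finset.set0;
  rate_ge0 : forall vartheta a s s',
    a \in avail s -> s' != s -> 0 <= rate vartheta a s s';
  rate_diag : forall vartheta a s,
    a \in avail s ->
    rate vartheta a s s = - \sum_(s' | s' != s) rate vartheta a s s';
  reward_gt0 : forall vartheta s a, 0 < reward vartheta s a }.

Section decision_processes.
Context {R : realType} {S A : finType} {Theta : Type}.
Variable M : ctmdp R S A Theta.

Definition is_policy (pi : S -> A -> R) : Prop :=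
  (forall s, is_distr (pi s)) /\ (forall s, \sum_(a in avail M s) pi s a = 1).

Definition is_reference_policy (mu : S -> A -> R) : Prop :=
  (forall s, is_distr (mu s)) /\
  (forall s a, (0 < mu s a) = (a \in avail M s)).

Definition policy_generator (pi : S -> A -> R) (vartheta : Theta) (s s' : S) :
    R :=
  \sum_(a in avail M s) pi s a * rate M vartheta a s s'.

(* Here and in [ell] the conventions [0 * ln (0 / x) = 0] hold automatically. *)
Definition KL (pi mu : S -> A -> R) (s : S) : R :=
  \sum_(a in avail M s) pi s a * ln (pi s a / mu s a).

(* Faithful only if [l' s s' = 0] implies [l s s' = 0]: otherwise the summand
   should be infinite, whereas here [x / 0 = 0] and [ln 0 = 0]. *)
Definition ell (l l' : S -> S -> R) (s : S) : R :=
  \sum_(s' | s' != s) (l s s' * ln (l s s' / l' s s') - (l s s' - l' s s')).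

Definition cost (r : R) (theta theta' : Theta) (s : S) (a : A) : R :=
  ell (rate M theta a) (rate M theta' a) s -
  r * ln (reward M theta' s a / reward M theta s a).

(* [dbar] stands for the occupancy measure under the baseline [theta]. *)
Definition uncertainty_set (r : R) (mu : S -> A -> R) (dbar : S -> R)
    (tau eps : R) (theta : Theta) : set Theta :=
  [set theta' |
    \sum_s dbar s *
      (tau * ln (\sum_(a in avail M s)
                   mu s a * expR (cost r theta theta' s a / tau))) <= eps].

Definition equivalent_rates (theta : Theta) : Prop :=
  forall theta' s s' a, a \in avail M s ->
    (0 < rate M theta a s s') <-> (0 < rate M theta' a s s').

End decision_processes.

(* Main.v *)
(** Let [D s] be the integral of [exp (- r t) P (X_t = s)] over [t >= 0] under the
    baseline law.  The Markov property gives [r D = rho + D Q]; the same holds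
    for the perturbed law, with [D'] and [Q'].  Let [V > 0] solve the resolvent
    equation [r V = f' + Q' V], where [f'] is the perturbed reward averaged over
    the policy, so that the perturbed value is [<D', f'> = <rho, V>].  By Jensen
    [ln <rho, V> >= <rho, ln V> = <D, r ln V - Q ln V>].  Three uses of
    [ln z <= z - 1] finish the proof: jump by jump, [Q ln V <= (Q' V) / V + ell];
    then [(Q' V) / V = r - f' / V] and [f' / (r V) - 1 >= ln (f' / (r V))], where
    Jensen bounds [ln f'] below by the averaged [ln R']; finally
    Gibbs' variational inequality bounds the policy average of the cost by
    [tau KL + tau ln (sum mu exp (c / tau))].

    The equation [r D = rho + D Q] comes from translating the integral by [h]:
    [D = int_0^h exp (- r t) q_t dt + exp (- r h) D p_h], where [q_t] is the law
    of [X_t]; divide by [h] and let [h] tend to [0]. *)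

From HB Require Import structures.
Require Import Defs.
From mathcomp Require Import all_boot all_order all_algebra.
From mathcomp Require Import all_classical all_reals all_analysis.
From mathcomp Require Import measurable_realfun.
From mathcomp Require Import ring lra.

Set Implicit Arguments.
Unset Strict Implicit.
Unset Printing Implicit Defensive.

Import Order.TTheory GRing.Theory Num.Theory.
Import numFieldNormedType.Exports.

Local Open Scope classical_set_scope.
Local Open Scope ring_scope.

(** * The deterministic inequalities and the resolvent *)

Section finite_sums.
Context {R : realType}.

Lemma ln_le_subr1 (x : R) : 0 < x -> ln x <= x - 1.
Proof.
by move=> x0; have := @le_ln1Dx R (x - 1); rewrite [1 + _]addrC subrK; apply; lra.
Qed.

(** For [a > 0] this is [ln z <= z - 1] at [z = b * y / a], multiplied by [a]; for [a = 0] it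
    reduces to [0 <= b * y]. *)
Lemma mulr_ln_le (a b y : R) : 0 <= a -> 0 <= b -> (0 < a -> 0 < b) ->
  0 < y -> a * ln y <= b * y - a + a * ln (a / b).
Proof.
rewrite le_eqVlt => /predU1P[<-|a0] b0 ab y0.
  by rewrite !mul0r !subr0 addr0 mulr_ge0// ltW.
have {}b0 := ab a0.
have h : ln (b * y / a) <= b * y / a - 1 by apply: ln_le_subr1; rewrite divr_gt0// mulr_gt0.
have e : ln (b * y / a) = ln y - ln (a / b).
  by rewrite !ln_div ?posrE ?mulr_gt0// lnM ?posrE//; ring.
rewrite e in h.
have := ler_wpM2l (ltW a0) h.
have -> : a * (b * y / a - 1) = b * y - a by field; exact: lt0r_neq0.
lra.
Qed.

(** Jensen for [ln], by its tangent line at the mean [m]. Single weights may vanish; that they sum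
    to [1] is what forces [m > 0]. *)
Lemma sum_ln_le (I : finType) (A : {pred I}) (p f : I -> R) :
  (forall i, i \in A -> 0 <= p i) -> \sum_(i in A) p i = 1 ->
  (forall i, i \in A -> 0 < f i) ->
  0 < \sum_(i in A) p i * f i /\
  \sum_(i in A) p i * ln (f i) <= ln (\sum_(i in A) p i * f i).
Proof.
move=> p0 p1 f0; set m := \sum_(i in A) p i * f i.
have m0 : 0 < m.
  have m_ge0 : 0 <= m by apply: sumr_ge0 => i iA; rewrite mulr_ge0 ?p0// ltW ?f0.
  rewrite lt_neqAle m_ge0 andbT; apply/eqP => /esym/psumr_eq0P H.
  have : \sum_(i in A) p i = 0.
    apply: big1 => i iA; have /eqP := H (fun i iA => mulr_ge0 (p0 i iA) (ltW (f0 i iA))) i iA.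
    by rewrite mulf_eq0 (gt_eqF (f0 i iA)) orbF => /eqP.
  by rewrite p1 => /eqP; rewrite oner_eq0.
split => //.
(* The added linear terms sum to [m / m - 1 = 0], so the comparison can be made term by term. *)
have -> : ln m = \sum_(i in A) (p i * ln m + (p i * f i / m - p i)).
  rewrite big_split sumrB/= -!mulr_suml p1 -/m divff ?gt_eqF//; ring.
apply: ler_sum => i iA.
have -> : p i * ln m + (p i * f i / m - p i) = p i * (ln m + (f i / m - 1)) by ring.
apply: ler_wpM2l; first exact: p0.
have := ln_le_subr1 (divr_gt0 (f0 i iA) m0).
rewrite ln_div ?posrE ?f0//; lra.
Qed.

(** [mulr_ln_le] is applied termwise with [y = expR (c i / tau) / Z]. This [y] has [m]-mean [1], the
    total mass of [p], so the linear terms cancel in the sum. *)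
Lemma gibbs_variational (I : finType) (A : {pred I}) (p m c : I -> R) (tau : R) :
  0 < tau -> (forall i, i \in A -> 0 <= p i) -> \sum_(i in A) p i = 1 ->
  (forall i, i \in A -> 0 < m i) ->
  \sum_(i in A) p i * c i <=
  tau * \sum_(i in A) p i * ln (p i / m i) +
  tau * ln (\sum_(i in A) m i * expR (c i / tau)).
Proof.
move=> tau0 p0 p1 m0; set Z := \sum_(i in A) m i * expR (c i / tau).
have [i0 i0A] : exists i, i \in A.
  apply/existsP; apply: contraT => /existsPn H.
  by move: p1; rewrite big_pred0 => [/esym/eqP|i]; [rewrite oner_eq0|apply/negbTE/H].
have Z0 : 0 < Z.
  rewrite /Z (bigD1 i0)//= ltr_pwDl// ?mulr_gt0 ?expR_gt0 ?m0//.
  by apply: sumr_ge0 => i /andP[iA _]; rewrite mulr_ge0 ?expR_ge0// ltW// m0.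
rewrite -mulrDr -ler_pdivrMl// mulr_sumr.
have -> : ln Z = \sum_(i in A) (p i * ln Z + (m i * expR (c i / tau) / Z - p i)).
  rewrite big_split sumrB/= -!mulr_suml p1 -/Z divff ?gt_eqF//; ring.
rewrite -big_split; apply: ler_sum => i iA /=.
have := @mulr_ln_le (p i) (m i) (expR (c i / tau) / Z) (p0 i iA) (ltW (m0 i iA)).
rewrite m0// divr_gt0 ?expR_gt0// => /(_ (fun=> erefl) erefl).
rewrite ln_div ?posrE ?expR_gt0// expRK.
have -> : tau^-1 * (p i * c i) = p i * (c i / tau) by ring.
rewrite !mulrA; lra.
Qed.

End finite_sums.

(** * The resolvent equation of a finite generator *)

Section resolvent.
Context {R : realType} {S : finType} (Q : S -> S -> R) (r : R).
Hypothesis Q_ge0 : forall s s', s' != s -> 0 <= Q s s'.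
Hypothesis Q_sum0 : forall s, \sum_s' Q s s' = 0.
Hypothesis r_gt0 : 0 < r.

Lemma generator_at_minimum (v : S -> R) (s : S) :
  (forall s', v s <= v s') -> 0 <= \sum_s' Q s s' * v s'.
Proof.
move=> vmin.
have -> : \sum_s' Q s s' * v s' = \sum_s' Q s s' * (v s' - v s).
  under [RHS]eq_bigr do rewrite mulrBr.
  by rewrite sumrB -mulr_suml Q_sum0 mul0r subr0.
apply: sumr_ge0 => s' _; have [->|s's] := eqVneq s' s.
  by rewrite subrr mulr0.
by rewrite mulr_ge0 ?Q_ge0// subr_ge0.
Qed.

(** Minimum principle: where [v] is smallest the generator term is nonnegative, so [r * v] dominates
    [f] there, and hence [e] everywhere. *)
Lemma resolvent_minimum (v f : S -> R) (e : R) :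
  (forall s, r * v s = f s + \sum_s' Q s s' * v s') ->
  (forall s, e <= f s) -> forall s, e <= r * v s.
Proof.
move=> vE fe s.
have [s0 _ s0min] := @arg_minP _ _ _ s xpredT v isT.
apply: (@le_trans _ _ (r * v s0)); last by rewrite ler_pM2l// s0min.
rewrite vE ler_wpDr// ?fe//.
by apply: generator_at_minimum => s'; exact: s0min.
Qed.

(** The minimum principle, applied to [v] and to [- v], makes [r - Q] injective; in finite dimension
    it is then surjective. *)
Lemma resolvent_ex (f : S -> R) :
  exists v : S -> R, forall s, r * v s = f s + \sum_s' Q s s' * v s'.
Proof.
(* [R^o] is [R] as a module over itself, which turns the finite functions into a vector space. *)
pose T (v : {ffun S -> R^o}) : {ffun S -> R^o} :=
  [ffun s => r * v s - \sum_s' Q s s' * v s'].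
have lT : linear T.
  move=> a u v; apply/ffunP => s; rewrite !ffunE.
  under eq_bigr do rewrite !ffunE.
  rewrite [X in _ - X](_ : _ = a * (\sum_s' Q s s' * u s') + \sum_s' Q s s' * v s').
    rewrite /GRing.scale/=; ring.
  rewrite mulr_sumr -big_split; apply: eq_bigr => s' _.
  rewrite /GRing.scale/=; ring.
pose TL := GRing.isLinear.Build _ _ _ _ T lT.
pose Tl : {linear {ffun S -> R^o} -> {ffun S -> R^o}} := HB.pack T TL.
have kT : lker (linfun Tl) == 0%VS.
  apply/eqP/eqP; rewrite -subv0; apply/subvP => v; rewrite memv_ker memv0 lfunE/= => /eqP Tv0.
  have Tv s : r * v s = \sum_s' Q s s' * v s'.
    by apply/eqP; rewrite -subr_eq0; have /ffunP/(_ s) := Tv0; rewrite !ffunE => ->.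
  apply/eqP/ffunP => s; rewrite ffunE.
  have h1 : 0 <= r * v s.
    by apply: (@resolvent_minimum v (fun=> 0) 0) => // x; rewrite add0r.
  have h2 : 0 <= r * (- v s).
    apply: (@resolvent_minimum (fun x => - v x) (fun=> 0) 0) => // x.
    by rewrite add0r mulrN Tv -sumrN; apply: eq_bigr => y _; rewrite mulrN.
  apply/eqP; rewrite eq_le -(pmulr_rge0 _ r_gt0) -(pmulr_rle0 _ r_gt0).
  by rewrite h1 andbT -oppr_ge0 -mulrN.
have /memv_imgP[v _ fE] : [ffun s => f s] \in limg (linfun Tl).
  by rewrite lker0_limgf ?memvf.
exists v => s; move/ffunP/(_ s): fE; rewrite lfunE/= !ffunE => ->.
by rewrite subrK.
Qed.

End resolvent.

(** * Discounted integrals of a right-continuous process *)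

Section discounting.
Context {R : realType} (r : R).
Hypothesis r_gt0 : 0 < r.
Local Notation mu := (@lebesgue_measure R).

(** Up to the factor [r^-1] the integrand is the density of the exponential law. *)
Lemma integrable_expRN :
  mu.-integrable `[0, +oo[ (EFin \o (fun t => expR (- (r * t)))).
Proof.
have h : mu.-integrable `[0, +oo[ (EFin \o exponential_pdf r).
  by apply: (@integrableS _ _ _ _ setT) => //; exact: integrable_exponential_pdf.
apply: eq_integrable (integrableZl _ r^-1 h) => // t.
rewrite inE/= in_itv/= andbT => t0.
by rewrite -EFinM exponential_pdfE// mulNr mulKf// gt_eqF.
Qed.

Lemma integrable_expRNM (h : R -> R) (b : R) : measurable_fun (`[0, +oo[ : set R) h ->
  (forall t, 0 <= t -> `|h t| <= b) ->
  mu.-integrable `[0, +oo[ (EFin \o (fun t => expR (- (r * t)) * h t)).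
Proof.
move=> mh hb.
have -> : EFin \o (fun t => expR (- (r * t)) * h t) =
    ((EFin \o (fun t => expR (- (r * t))%R)) \* (EFin \o h))%E by [].
apply: integrableMl => //; first exact: integrable_expRN.
exists b; split; first exact: num_real.
move=> M bM t /=; rewrite in_itv/= andbT => t0.
by rewrite (le_trans (hb _ t0))// ltW.
Qed.

End discounting.

Section right_continuous_process.
Context {R : realType} {S : finType} d (Omega : measurableType d).
Variable X : R -> Omega -> S.
Hypothesis mX : forall t s, 0 <= t -> measurable [set w | X t w = s].
Hypothesis rcX : forall w t, 0 <= t -> \forall u \near t^'+, X u w = X t w.

(* [X] is the limit of the processes frozen, on each cell of the grid of mesh
   [1 / (n + 1)], at the right endpoint of the cell. *)
Lemma measurable_right_continuous s :
  measurable [set z : R * Omega | 0 <= z.1 /\ X z.1 z.2 = s].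
Proof.
pose grid n k : R := k%:R / n.+1%:R.
pose B n := \bigcup_k
  (`[grid n k, grid n k.+1[%classic `*` [set w | X (grid n k.+1) w = s]).
have grid_ge0 n k : 0 <= grid n k by rewrite divr_ge0.
have mB n : measurable (B n).
  by apply: bigcup_measurable => k _; apply: measurableX => //; exact: mX.
suff -> : [set z : R * Omega | 0 <= z.1 /\ X z.1 z.2 = s] =
    \bigcup_N \bigcap_(n in [set n | (N <= n)%N]) B n.
  by apply: bigcup_measurable => N _; apply: bigcap_measurable => //; exists N => /=.
(* Cells are closed on the left and open on the right, so the right endpoint lies strictly after
   [t], within one mesh, where right-continuity controls the path. *)
have key t w : 0 <= t -> exists N, forall n k, (N <= n)%N ->
    t \in `[grid n k, grid n k.+1[ -> X (grid n k.+1) w = X t w.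
  move=> t0; have [e/= e0 eX] := rcX w t0.
  have [N _ Ne] := near_infty_natSinv_lt (PosNum e0).
  exists N => n k Nn; rewrite in_itv/= => /andP[kt tk].
  apply: eX => //=; rewrite ltr_distl.
  have := Ne n Nn => /= ne.
  have gS : grid n k.+1 = grid n k + n.+1%:R^-1.
    by rewrite /grid -natr1 mulrDl mul1r.
  by rewrite (lt_le_trans _ kt) ?(lt_trans tk) ?ltrDl// gS -addrA gtrDl subr_lt0.
have cell n t : 0 <= t -> exists k, t \in `[grid n k, grid n k.+1[.
  move=> t0; exists (Num.truncn (t * n.+1%:R)).
  by rewrite in_itv/= ler_pdivrMr// ltr_pdivlMr// truncn_itv// mulr_ge0.
apply/seteqP; split => [[t w]/= [t0 Xs]|[t w] [N _ BN]].
  have [N NX] := key t w t0.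
  exists N => // n/= Nn; have [k tk] := cell n t t0.
  by exists k => //; split => //=; rewrite (NX n k Nn tk).
have t0 : 0 <= t.
  have [k _ [/= + _]] := BN N (leqnn _).
  by rewrite in_itv/= => /andP[+ _]; exact: le_trans.
have [N' NX] := key t w t0.
have [k _ [/= tk Xs]] := BN (maxn N N') (leq_maxl _ _).
by split => //=; rewrite -(NX _ k (leq_maxr _ _) tk).
Qed.


(** A path is a section of the jointly measurable set above. *)
Lemma measurable_state_indicator s w :
  measurable_fun (`[0, +oo[ : set R) (fun t => (X t w == s)%:R : R).
Proof.
set A := [set z : R * Omega | 0 <= z.1 /\ X z.1 z.2 = s].
apply: (eq_measurable_fun (fun t : R => \1_A (t, w) : R)); last first.
  apply: measurable_funTS; apply: measurable_fun_pair1.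
  by apply: measurable_indic; exact: measurable_right_continuous.
move=> t; rewrite inE/= in_itv/= andbT => t0.
rewrite indicE; congr (nat_of_bool _)%:R; apply/idP/idP; first by rewrite inE/= => -[_ ->].
by move=> /eqP Xs; rewrite inE.
Qed.

Variables (P : probability Omega R) (r : R) (q : R -> S -> R).
Hypothesis r_gt0 : 0 < r.
Hypothesis mq : forall s, measurable_fun (`[0, +oo[ : set R) (q ^~ s).
Hypothesis PX : forall t s, 0 <= t -> P [set w | X t w = s] = (q t s)%:E.
Local Notation mu := (@lebesgue_measure R).

Lemma marginal_itv01 t s : 0 <= t -> 0 <= q t s <= 1.
Proof.
move=> t0; rewrite -!lee_fin -PX// measure_ge0/=.
by rewrite probability_le1//; exact: mX.
Qed.

Lemma integrable_discounted_state s w :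
  mu.-integrable `[0, +oo[ (EFin \o (fun t => expR (- (r * t)) * (X t w == s)%:R)).
Proof.
apply: (@integrable_expRNM _ _ r_gt0 _ 1); first exact: measurable_state_indicator.
by move=> t _; case: (_ == _); rewrite ?normr1 ?normr0.
Qed.

Lemma integrable_discounted_marginal s :
  mu.-integrable `[0, +oo[ (EFin \o (fun t => expR (- (r * t)) * q t s)).
Proof.
apply: (@integrable_expRNM _ _ r_gt0 _ 1); first exact: mq.
by move=> t t0; have /andP[q0 q1] := marginal_itv01 s t0; rewrite ger0_norm.
Qed.

Lemma discounted_integralE (f : S -> R) w :
  discounted_integral r X f w =
  \sum_s f s * discounted_integral r X (fun s' => (s' == s)%:R) w.
Proof.
rewrite /discounted_integral.
have iZ s : mu.-integrable `[0, +oo[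
    (EFin \o (fun t => f s * (expR (- (r * t)) * (X t w == s)%:R))).
  apply: eq_integrable (integrableZl _ (f s) (integrable_discounted_state s w)) => //.
rewrite (eq_bigr (fun s => (\int[mu]_(t in `[0, +oo[)
    (f s * (expR (- (r * t)) * (X t w == s)%:R)))%R)); last first.
  by move=> s _; rewrite RintegralZl//; exact: integrable_discounted_state.
rewrite /Rintegral sum_fine; last first.
  by move=> s _; exact: integrable_fin_num (iZ s).
congr fine; rewrite -integral_sum//.
apply: eq_integral => t _; rewrite sumEFin; congr EFin.
rewrite (bigD1 (X t w))//= eqxx mulr1 big1 ?addr0 1?mulrC// => s /negbTE.
by rewrite eq_sym => ->; rewrite !mulr0.
Qed.

Lemma discounted_integral_ge0 s w :
  0 <= discounted_integral r X (fun s' => (s' == s)%:R) w.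
Proof. by apply: Rintegral_ge0 => t _; rewrite mulr_ge0 ?expR_ge0. Qed.

(** The integrand for Tonelli's theorem. Negative times are cut off by the indicator, so it is
    defined and measurable on the whole product. *)
Let F s (z : R * Omega) : \bar R :=
  (expR (- (r * z.1)) * \1_[set z : R * Omega | 0 <= z.1 /\ X z.1 z.2 = s] z)%:E.

Let mF s : measurable_fun setT (F s).
Proof.
apply/measurable_EFinP/measurable_funM.
  apply: measurableT_comp => //; apply: measurable_funN.
  by apply: measurable_funM => //; exact: measurable_fst.
by apply: measurable_indic; exact: measurable_right_continuous.
Qed.

Let F_ge0 s z : (0 <= F s z)%E.
Proof. by rewrite lee_fin mulr_ge0 ?expR_ge0. Qed.

Let F_patch s t w : F s (t, w) =
  ((EFin \o (fun t => expR (- (r * t)) * (X t w == s)%:R)) \_ `[0, +oo[) t.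
Proof.
rewrite patchE mem_setE in_itv/= andbT /F indicE/=.
have -> : ((t, w) \in [set z : R * Omega | 0 <= z.1 /\ X z.1 z.2 = s]) =
    (0 <= t) && (X t w == s).
  by apply/idP/andP; rewrite inE/= => -[? /eqP].
by case: ifPn => [//|_]; rewrite mulr0.
Qed.

Let integral_F1 s w :
  (\int[mu]_t F s (t, w) =
   (discounted_integral r X (fun s' => (s' == s)%:R) w)%:E)%E.
Proof.
under eq_integral do rewrite F_patch.
rewrite -integral_mkcond /discounted_integral /Rintegral fineK//.
exact/integrable_fin_num/integrable_discounted_state.
Qed.

Let integral_F2 s t : (\int[P]_w F s (t, w))%E =
  ((EFin \o (fun t => expR (- (r * t)) * q t s)) \_ `[0, +oo[) t.
Proof.
under eq_integral do rewrite F_patch.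
rewrite patchE mem_setE in_itv/= andbT; case: ifPn => t0; last first.
  by apply: integral0_eq => w _; rewrite patchE mem_setE in_itv/= andbT (negbTE t0).
transitivity (\int[P]_w ((expR (- (r * t)))%:E * (\1_[set w | X t w = s] w)%:E))%E.
  apply: eq_integral => w _; rewrite patchE mem_setE in_itv/= andbT t0.
  rewrite EFinM indicE; congr (_ * (nat_of_bool _)%:R%:E)%E.
  by apply/idP/idP; rewrite inE/= => /eqP.
have mA : measurable [set w | X t w = s] by exact: mX.
rewrite ge0_integralZl//.
- by rewrite integral_indic// setIT EFinM; congr (_ * _)%E; exact: PX.
- by apply/measurable_EFinP; exact: measurable_indic.
Qed.

Definition discounted_marginal s : R :=
  (\int[mu]_(t in `[0, +oo[) (expR (- (r * t)) * q t s))%R.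

Lemma integral_discounted_state s :
  (\int[P]_w (discounted_integral r X (fun s' => (s' == s)%:R) w)%:E =
   (discounted_marginal s)%:E)%E.
Proof.
under eq_integral do rewrite -integral_F1.
transitivity (\int[mu]_t \int[P]_w F s (t, w))%E.
  by rewrite (fubini_tonelli (m1 := mu) (m2 := P) _ (mF s) (F_ge0 s)).
under eq_integral do rewrite integral_F2.
rewrite -integral_mkcond /discounted_marginal /Rintegral fineK//.
exact: integrable_fin_num (integrable_discounted_marginal s).
Qed.

(** Tonelli gives both halves: measurability as a partial integral of [F], and finiteness from the
    value of the double integral. *)
Lemma integrable_discounted_integral s :
  P.-integrable setT
    (EFin \o discounted_integral r X (fun s' => (s' == s)%:R)).
Proof.
apply/integrableP; split.
  apply: (eq_measurable_fun (fubini_G mu (F s))).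
    by move=> w _; rewrite /fubini_G integral_F1.
  exact: (measurable_fun_fubini_tonelli_G (m1 := mu) _ (mF s) (F_ge0 s)).
under eq_integral do rewrite /= ger0_norm ?discounted_integral_ge0//.
by rewrite integral_discounted_state ltry.
Qed.

Lemma discounted_expectationE (f : S -> R) :
  discounted_expectation P r X f = (\sum_s f s * discounted_marginal s)%:E.
Proof.
rewrite /discounted_expectation unlock.
under eq_integral do rewrite discounted_integralE -sumEFin.
rewrite integral_sum//; last first.
  by move=> s; exact: (integrableZl _ _ (integrable_discounted_integral s)).
rewrite -sumEFin; apply: eq_bigr => s _.
under eq_integral do rewrite EFinM.
rewrite integralZl//; last exact: integrable_discounted_integral.
by rewrite integral_discounted_state EFinM.
Qed.

Lemma occupancyE s : occupancy P r X s = r * discounted_marginal s.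
Proof.
rewrite /occupancy discounted_expectationE/= (bigD1 s)//= eqxx mul1r.
by rewrite big1 ?addr0// => s' /negbTE ->; rewrite mul0r.
Qed.

End right_continuous_process.

Lemma cvg_sumr (R : realType) (T I : Type) (F : set_system T) {FF : Filter F}
  (s : seq I) (f : I -> T -> R) (l : I -> R) :
  (forall i, f i x @[x --> F] --> l i) ->
  \sum_(i <- s) f i x @[x --> F] --> \sum_(i <- s) l i.
Proof.
move=> fl; elim: s => [|i s IH].
  by rewrite big_nil; under eq_fun do rewrite big_nil; exact: cvg_cst.
by rewrite big_cons; under eq_fun do rewrite big_cons; exact: cvgD.
Qed.

(** * Translation and right averages of integrals on the line *)

Section shifted_integral.
Context {R : realType}.
Local Notation mu := (@lebesgue_measure R).

Lemma Rintegral_shift (K : R -> R) (h : R) : continuous K -> (forall t, 0 <= K t) ->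
  (\int[mu]_(t in `[h, +oo[) K t)%R = (\int[mu]_(t in `[0, +oo[) K (t + h))%R.
Proof.
move=> cK K0; pose F (x : R) : R := x + h.
have dF x : derivable F x 1 by apply: derivableD.
have F'E : derive1 F = cst 1.
  by apply/funext => x; rewrite derive1E deriveD// derive_id derive_cst addr0.
rewrite /Rintegral; congr fine.
have -> : h = F 0 by rewrite /F add0r.
rewrite (@increasing_ge0_integration_by_substitutiony _ F K 0).
- by apply: eq_integral => x _; rewrite F'E/= mulr1 /F add0r.
- by move=> x y _ _ xy; rewrite /F ltrD2r.
- by rewrite F'E => x _; exact: cvg_cst.
- by rewrite F'E; exact: is_cvg_cst.
- by rewrite F'E; exact: is_cvg_cst.
- split; first by move=> x _; exact: dF.
  by apply: cvg_at_right_filter; apply: differentiable_continuous; apply/derivable1_diffP/dF.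
- exact: cvg_addrr.
- exact: continuous_subspaceT.
- by [].
Qed.

Lemma cvg_average_right (K : R -> R) : continuous K ->
  h^-1 * (\int[mu]_(t in `[0, h]) K t)%R @[h --> 0^'+] --> K 0.
Proof.
(* Starting the primitive at [-1] makes [0] an interior point, where the fundamental theorem yields
   a two-sided derivative. *)
move=> cK; pose F (x : R) : R := (\int[mu]_(t in [set` `[- 1, x]]) (K t))%R.
have iK a b : mu.-integrable `[a, b] (EFin \o K).
  apply: continuous_compact_integrable; first exact: segment_compact.
  exact: continuous_subspaceT.
have [dF F'] : derivable F 0 1 /\ derive1 F 0 = K 0.
  by apply: (@continuous_FTC1_closed _ K (- 1) 0 1) => //; rewrite ?ltrN10//; exact: cK.
have /cvg_dnbhs_at_right : h^-1 *: (F (h *: 1 + 0) - F 0) @[h --> 0^'] --> K 0.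
  by rewrite -F' derive1E; exact: dF.
apply: cvg_trans; apply: near_eq_cvg; near=> h.
have h0 : 0 < h by near: h; exact: nbhs_right_gt.
rewrite addr0 /GRing.scale/= mulr1; congr (_ * _).
rewrite /F Rintegral_itvB//.
- by rewrite Rintegral_itv_obnd_cbnd//; apply: integrableS (iK 0 h) => //; exact: subset_itv_oc_cc.
- by rewrite bnd_simp lerN10.
- by rewrite bnd_simp ltW.
Unshelve. all: by end_near. Qed.

End shifted_integral.

(** * The forward equation *)

Section forward_equation.
Context {R : realType} {S : finType}.
Variables (rho : S -> R) (Q : S -> S -> R) (p : R -> S -> S -> R) (r : R).
Hypothesis rho_distr : is_distr rho.
Hypothesis p_semigroup : transition_semigroup Q p.
Hypothesis r_gt0 : 0 < r.
Local Notation mu := (@lebesgue_measure R).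

Definition marginal (t : R) (s : S) : R := \sum_x rho x * p t x s.

Lemma marginal_distr t : 0 <= t -> is_distr (marginal t).
Proof.
have [pd _ _ _] := p_semigroup; have [rho0 rho1] := rho_distr => t0; split.
  by move=> s; apply: sumr_ge0 => x _; rewrite mulr_ge0//; have [] := pd _ x t0.
rewrite exchange_big/= -rho1; apply: eq_bigr => x _.
by rewrite -mulr_sumr; have [_ ->] := pd _ x t0; rewrite mulr1.
Qed.

Lemma marginal0 s : marginal 0 s = rho s.
Proof.
have [_ p0 _ _] := p_semigroup; rewrite /marginal (bigD1 s)//= p0 eqxx mulr1.
by rewrite big1 ?addr0// => x /negbTE xs; rewrite p0 xs mulr0.
Qed.

Lemma marginalD t h s : 0 <= t -> 0 <= h ->
  marginal (t + h) s = \sum_x marginal t x * p h x s.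
Proof.
have [_ _ pD _] := p_semigroup => t0 h0; rewrite /marginal.
under eq_bigr do rewrite pD// mulr_sumr.
rewrite exchange_big/=; apply: eq_bigr => x _.
by rewrite mulr_suml; apply: eq_bigr => y _; rewrite mulrA.
Qed.

Lemma marginal_itv t s : 0 <= t -> 0 <= marginal t s <= 1.
Proof.
move=> t0; have [m0 m1] := marginal_distr t0; rewrite m0 -m1 (bigD1 s)//=.
by rewrite lerDl sumr_ge0.
Qed.

(** The difference quotient converges, so [h] times it tends to [0]. *)
Lemma semigroup_cvg0 x s : p h x s @[h --> 0^'+] --> ((x == s)%:R : R).
Proof.
have [_ _ _ pQ] := p_semigroup.
have h0 : h @[h --> (0:R)^'+] --> (0 : R) by apply: cvg_at_right_filter; exact: cvg_id.
have : h * (h^-1 * (p h x s - (x == s)%:R)) + (x == s)%:R @[h --> 0^'+]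
    --> 0 * Q x s + (x == s)%:R.
  by apply: cvgD; [exact: cvgM h0 (pQ x s)|exact: cvg_cst].
rewrite mul0r add0r; apply: cvg_trans; apply: near_eq_cvg; near=> h.
have hgt0 : 0 < h by near: h; exact: nbhs_right_gt.
by rewrite mulVKf ?gt_eqF// subrK.
Unshelve. all: by end_near. Qed.

Let modulus s h : R := \sum_x `|p h x s - (x == s)%:R|.

Let modulus_cvg0 s : modulus s h @[h --> 0^'+] --> (0 : R).
Proof.
rewrite [X in _ --> X](_ : 0 = \sum_(x : S) (0 : R)); last by rewrite big1.
apply: cvg_sumr => x; rewrite -[X in _ --> X](@normr0 _ R^o); apply: cvg_norm.
rewrite -[X in _ --> X](subrr ((x == s)%:R : R)).
by apply: cvgB; [exact: semigroup_cvg0|exact: cvg_cst].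
Qed.

(** By Chapman-Kolmogorov the increment pairs [marginal t], whose entries lie in [[0, 1]], with a
    column of [p h] minus the identity. The bound does not depend on [t]. *)
Let marginal_modulus t h s : 0 <= t -> 0 <= h ->
  `|marginal (t + h) s - marginal t s| <= modulus s h.
Proof.
move=> t0 h0; rewrite marginalD//.
have -> : marginal t s = \sum_x marginal t x * (x == s)%:R.
  rewrite (bigD1 s)//= eqxx mulr1 big1 ?addr0// => x /negbTE ->.
  by rewrite mulr0.
rewrite -sumrB (le_trans (ler_norm_sum _ _ _))//; apply: ler_sum => x _.
rewrite -mulrBr normrM; have /andP[m0 m1] := marginal_itv x t0.
by rewrite ger0_norm// ler_piMl.
Qed.

(* Only times [t >= 0] are meaningful; extending the marginal by its value at
   [0] makes it continuous on the whole line. *)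
Definition marginal_ext (s : S) (t : R) : R := marginal (Num.max 0 t) s.

(** Because the modulus is uniform in time, it can be used from the earlier of two times;
    right-continuity of the semigroup at [0] thus gives continuity from both sides. *)
Lemma continuous_marginal_ext s : continuous (marginal_ext s).
Proof.
have mod_lt e : 0 < e -> exists2 d : R, 0 < d &
    forall t u, 0 <= t -> t <= u -> u - t < d ->
      `|marginal u s - marginal t s| < e.
  move=> e0; have /cvgrPdist_lt/(_ e e0)[/= d d0 H] := modulus_cvg0 s.
  exists d => // t u t0 tu utd.
  have [<-|ut] := eqVneq t u; first by rewrite subrr normr0.
  have ut0 : 0 < u - t by rewrite subr_gt0 lt_neqAle ut.
  rewrite -{1}(subrKC t u); apply: le_lt_trans (marginal_modulus _ t0 (ltW ut0)) _.
  have := H (u - t); rewrite /= !sub0r !normrN gtr0_norm// => /(_ utd ut0).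
  by rewrite ger0_norm// sumr_ge0.
move=> t; apply/cvgrPdist_lt => e /mod_lt[d d0 H].
near=> u; rewrite /marginal_ext.
(* Truncation at [0] is 1-Lipschitz. *)
have tud : `|Num.max 0 t - Num.max 0 u| < d.
  have : `|t - u| < d by near: u; apply: cvgr_dist_lt.
  apply: le_lt_trans; rewrite ler_norml.
  have := ler_norm (t - u); have := ler_norm (u - t); rewrite (distrC u t).
  by move: `|t - u| => a; rewrite /Num.max; do 2 case: ltP => ?; lra.
have t0 : 0 <= Num.max 0 t by rewrite le_max lexx.
have u0 : 0 <= Num.max 0 u by rewrite le_max lexx.
have [tu|/ltW ut] := leP (Num.max 0 t) (Num.max 0 u).
  rewrite distrC; apply: H => //.
  by rewrite -(ger0_norm (_ : 0 <= _ - _)) ?subr_ge0// distrC.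
by apply: H => //; rewrite -(ger0_norm (_ : 0 <= _ - _)) ?subr_ge0.
Unshelve. all: by end_near. Qed.

Lemma measurable_marginal s : measurable_fun (`[0, +oo[ : set R) (marginal ^~ s).
Proof.
apply: (eq_measurable_fun (marginal_ext s)).
  by move=> t; rewrite inE/= in_itv/= andbT /marginal_ext => /max_idPr ->.
apply: measurable_funTS; apply: continuous_measurable_fun.
exact: continuous_marginal_ext.
Qed.

Lemma integrable_expRN_marginal s :
  mu.-integrable `[0, +oo[ (EFin \o (fun t => expR (- (r * t)) * marginal t s)).
Proof.
apply: (@integrable_expRNM _ _ r_gt0 _ 1); first exact: measurable_marginal.
by move=> t t0; have /andP[m0 m1] := marginal_itv s t0; rewrite ger0_norm.
Qed.

Local Notation D := (discounted_marginal r marginal).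

Lemma discounted_marginal_ge0 s : 0 <= D s.
Proof.
apply: Rintegral_ge0 => t /=; rewrite in_itv/= andbT => t0.
by rewrite mulr_ge0 ?expR_ge0//; have /andP[] := marginal_itv s t0.
Qed.

(** The integrand of [D s], made continuous on the whole line so that translation and averaging at
    [0] apply to it. *)
Let K s t : R := expR (- (r * t)) * marginal_ext s t.

Let cK s : continuous (K s).
Proof.
move=> t; apply: cvgM; last exact: continuous_marginal_ext.
apply: continuous_comp; last exact: continuous_expR.
by apply: cvgN; apply: cvgM; [exact: cvg_cst|exact: cvg_id].
Qed.

Let K_ge0 s t : 0 <= K s t.
Proof.
rewrite mulr_ge0 ?expR_ge0//.
have m0 : 0 <= Num.max 0 t by rewrite le_max lexx.
by have /andP[] := marginal_itv s m0.
Qed.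

Let KE s t : 0 <= t -> K s t = expR (- (r * t)) * marginal t s.
Proof. by move=> t0; rewrite /K /marginal_ext (max_idPr t0). Qed.

Let DE s : D s = (\int[mu]_(t in `[0, +oo[) K s t)%R.
Proof.
by apply: eq_Rintegral => t; rewrite inE/= in_itv/= andbT => t0; rewrite KE.
Qed.

Let iK s : mu.-integrable `[0, +oo[ (EFin \o K s).
Proof.
apply: eq_integrable (integrable_expRN_marginal s) => // t.
by rewrite inE/= in_itv/= andbT => t0; rewrite /= KE.
Qed.

(** After the translation by [h], the exponential factors and Chapman-Kolmogorov lets [p h] come out
    of the integral. *)
Let tail_shift s h : 0 <= h ->
  (\int[mu]_(t in `[h, +oo[) K s t)%R = expR (- (r * h)) * \sum_x D x * p h x s.
Proof.
move=> h0; rewrite Rintegral_shift//.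
have E t : 0 <= t -> K s (t + h) =
    \sum_x (expR (- (r * h)) * p h x s) * (expR (- (r * t)) * marginal t x).
  move=> t0; rewrite KE ?addr_ge0// marginalD// mulr_sumr; apply: eq_bigr => x _.
  by rewrite mulrDr opprD expRD; ring.
have iZ x : mu.-integrable `[0, +oo[ (EFin \o (fun t =>
    (expR (- (r * h)) * p h x s) * (expR (- (r * t)) * marginal t x))).
  apply: eq_integrable (integrableZl _ (expR (- (r * h)) * p h x s)
    (integrable_expRN_marginal x)) => //.
have -> : (\int[mu]_(t in `[0, +oo[) K s (t + h))%R =
    \sum_x (\int[mu]_(t in `[0, +oo[) ((expR (- (r * h)) * p h x s) *
      (expR (- (r * t)) * marginal t x)))%R.
  rewrite /Rintegral sum_fine; last by move=> x _; exact: integrable_fin_num (iZ x).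
  congr fine; rewrite -integral_sum//; apply: eq_integral => t.
  by rewrite inE/= in_itv/= andbT => t0; rewrite E// sumEFin.
rewrite mulr_sumr; apply: eq_bigr => x _.
rewrite RintegralZl//; last exact: integrable_expRN_marginal.
rewrite -[X in _ * X = _]/(D x); ring.
Qed.

Let D_split s h : 0 < h ->
  D s = (\int[mu]_(t in `[0%R, h]) K s t)%R + expR (- (r * h)) * \sum_x D x * p h x s.
Proof.
move=> h0; rewrite -(tail_shift _ (ltW h0)) DE -(@Rintegral_itv_obnd_cbnd _ h); last first.
  apply: integrableS (iK s) => // t /=; rewrite !in_itv/= !andbT.
  by move=> /ltW; exact: le_trans (ltW h0).
by rewrite -(Rintegral_itvB (iK s)) ?bnd_simp ?(ltW h0)// addrC subrK.
Qed.

Lemma discounted_marginal_forward s :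
  r * D s = rho s + \sum_x D x * Q x s.
Proof.
have [_ _ _ pQ] := p_semigroup.
have h0 : h @[h --> (0:R)^'+] --> (0 : R) by apply: cvg_at_right_filter; exact: cvg_id.
have cE : expR (- (r * h)) @[h --> 0^'+] --> (1 : R).
  have -> : (1 : R) = expR (- (r * 0)) by rewrite mulr0 oppr0 expR0.
  apply: (cvg_comp (fun h => - (r * h)) expR); last exact: continuous_expR.
  by apply: cvgN; apply: cvgM; [exact: cvg_cst|exact: h0].
have dE : h^-1 * (1 - expR (- (r * h))) @[h --> 0^'+] --> r.
  (* The chain rule gives [expR (- r * h)] the derivative [- r] at [0]; the limit from the right is
     then negated. *)
  have lin : is_derive (0 : R) (1 : R) ( *%R (- r)) (- r).
    rewrite -[X in is_derive _ _ _ X]mulr1.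
    exact: (@is_deriveZ R R^o R^o id (- r) 0 1 1 (is_derive_id _ _)).
  have := is_derive1_comp (is_derive_expR (- r * 0)) lin.
  rewrite [X in is_derive _ _ _ X](_ : _ = - r); last by rewrite mulr0 expR0 mul1r.
  move=> [de deE].
  have : h^-1 *: (expR (- r * (h *: 1 + 0)) - expR (- r * 0)) @[h --> (0:R)^'] --> (- r : R).
    by rewrite -[X in _ --> X]deE; exact: de.
  move=> /cvg_dnbhs_at_right/cvgN; rewrite opprK; apply: cvg_trans.
  apply: near_eq_cvg; near=> h.
  rewrite -[LHS]/(- (h^-1 * (expR (- r * (h * 1 + 0)) - expR (- r * 0)))).
  by rewrite -mulrN opprB addr0 mulr1 mulr0 expR0 mulNr.
have L1 : h^-1 * (1 - expR (- (r * h))) * D s @[h --> 0^'+] --> r * D s.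
  by apply: cvgM => //; exact: cvg_cst.
(* By [D_split] this is the same function of small [h > 0] as in [L1], so uniqueness of limits gives
   the equation. *)
have L2 : h^-1 * (\int[mu]_(t in `[0%R, h]) K s t)%R +
    expR (- (r * h)) * \sum_x D x * (h^-1 * (p h x s - (x == s)%:R))
    @[h --> 0^'+] --> rho s + 1 * \sum_x D x * Q x s.
  apply: cvgD.
    have -> : rho s = K s 0.
      by rewrite KE// mulr0 oppr0 expR0 mul1r marginal0.
    exact: cvg_average_right.
  apply: cvgM => //; apply: cvg_sumr => x.
  by apply: cvgM; [exact: cvg_cst|exact: pQ].
rewrite -[RHS](mul1r) mulrDr !mul1r -[X in _ + X](mul1r).
apply: cvg_unique L1 _ => //; apply: cvg_trans L2; apply: near_eq_cvg; near=> h.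
have hgt0 : 0 < h by near: h; exact: nbhs_right_gt.
have hD := D_split s hgt0.
have -> : \sum_x D x * (h^-1 * (p h x s - (x == s)%:R)) =
    h^-1 * (\sum_x D x * p h x s - D s).
  have -> : D s = \sum_x D x * (x == s)%:R.
    rewrite (bigD1 s)//= eqxx mulr1 big1 ?addr0// => x /negbTE ->.
    by rewrite mulr0.
  by rewrite -sumrB mulr_sumr; apply: eq_bigr => x _; ring.
have -> : (\int[mu]_(t in `[0%R, h]) K s t)%R =
    D s - expR (- (r * h)) * \sum_x D x * p h x s by rewrite {1}hD addrK.
ring.
Unshelve. all: by end_near. Qed.

End forward_equation.

(** * Occupancy measures and robustness *)

Section markov_chain_occupancy.
Context {R : realType} {S : finType} d (Omega : measurableType d).
Variables (P : probability Omega R) (X : R -> Omega -> S).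
Variables (rho : S -> R) (Q : S -> S -> R) (r : R).
Hypothesis rho_distr : is_distr rho.
Hypothesis r_gt0 : 0 < r.

Lemma markov_chain_marginal p :
  (forall t s, 0 <= t -> measurable [set w | X t w = s]) ->
  (forall (n : nat) (t : nat -> R) (x : nat -> S),
    t 0%N = 0 -> (forall k, t k <= t k.+1) ->
    P [set w | forall k, (k <= n)%N -> X (t k) w = x k] =
    (rho (x 0%N) * \prod_(k < n) p (t k.+1 - t k) (x k) (x k.+1))%:E) ->
  forall t s, 0 <= t -> P [set w | X t w = s] = (marginal rho p t s)%:E.
Proof.
move=> mX fdd t s t0.
pose A x := [set w | X 0 w = x] `&` [set w | X t w = s].
have mA x : measurable (A x) by apply: measurableI; exact: mX.
have PA x : P (A x) = (rho x * p t x s)%:E.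
  (* Only indices [0] and [1] enter the event; staying at [t] afterwards keeps the infinite time
     sequence nondecreasing. *)
  have := fdd 1%N (fun k => if k is 0%N then 0 else t) (fun k => if k is 0%N then x else s).
  rewrite big_ord1/= subr0 => <-//; last by case.
  congr (P _); apply/seteqP; split => w.
    by move=> [X0 Xt] [|[|]].
  by move=> H; split; [exact: (H 0%N)|exact: (H 1%N)].
rewrite /marginal -sumEFin; under eq_bigr do rewrite -PA.
have intA B : measurable B -> P B = (\int[P]_w (\1_B w)%:E)%E.
  by move=> mB; rewrite integral_indic// setIT.
rewrite intA; last exact: mX.
rewrite (eq_bigr (fun x => \int[P]_w (\1_(A x) w)%:E)%E); last by move=> x _; exact: intA.
rewrite -ge0_integral_sum//; last first.
  by move=> x; apply/measurable_EFinP; exact: measurable_indic.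
apply: eq_integral => w _; rewrite sumEFin; congr EFin.
rewrite (bigD1 (X 0 w))//= big1 ?addr0.
  by rewrite !indicE; congr (nat_of_bool _)%:R; apply/idP/idP; rewrite !inE => // -[].
move=> x /eqP xX; rewrite indicE; case: (boolP (w \in A x)) => //.
by rewrite inE => -[/= /esym].
Qed.

(** This collects all that the robustness argument needs from the process: from here on only the
    finite vector [D] and its forward equation matter. *)
Lemma markov_chain_occupancy : markov_chain P X rho Q ->
  exists D : S -> R,
  [/\ forall f, discounted_expectation P r X f = (\sum_s f s * D s)%:E,
      forall s, occupancy P r X s = r * D s,
      forall s, 0 <= D s &
      forall s, r * D s = rho s + \sum_x D x * Q x s].
Proof.
move=> [mX rcX [p psg fdd]].
have PX := markov_chain_marginal mX fdd.
have mq := measurable_marginal rho_distr psg.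
exists (discounted_marginal r (marginal rho p)); split.
- by move=> f; exact: discounted_expectationE.
- by move=> s; exact: occupancyE.
- by move=> s; exact: discounted_marginal_ge0 rho_distr psg _.
- by move=> s; exact: discounted_marginal_forward.
Qed.

End markov_chain_occupancy.

(** * The robustness bound *)

Section robustness.
Context {R : realType} {S A : finType} {Theta : Type}.
Variables (M : ctmdp R S A Theta) (pi mu : S -> A -> R).
Hypothesis pi_policy : is_policy M pi.
Hypothesis mu_ref : is_reference_policy M mu.

Let pi_ge0 s a : 0 <= pi s a. Proof. by have [] := pi_policy.1 s. Qed.

Let pi_sum1 s : \sum_(a in avail M s) pi s a = 1. Proof. exact: pi_policy.2. Qed.

Lemma policy_generator_ge0 vartheta s s' : s' != s ->
  0 <= policy_generator M pi vartheta s s'.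
Proof. by move=> s's; apply: sumr_ge0 => a aA; rewrite mulr_ge0 ?rate_ge0. Qed.

Lemma policy_generator_sum0 vartheta s :
  \sum_s' policy_generator M pi vartheta s s' = 0.
Proof.
rewrite exchange_big/= big1// => a aA; rewrite -mulr_sumr (bigD1 s)//=.
by rewrite rate_diag// addNr mulr0.
Qed.

(* [l ln y <= l' y - l + l ln (l / l')] with [y = V s' / V s], summed over the
   jumps [s -> s'], bounds the generator applied to [ln V]. *)
Lemma generator_ln_le (theta theta' : Theta) (V : S -> R) s :
  equivalent_rates M theta -> (forall s, 0 < V s) ->
  \sum_s' policy_generator M pi theta s s' * ln (V s') <=
  (\sum_s' policy_generator M pi theta' s s' * V s') / V s +
  \sum_(a in avail M s) pi s a * ell (rate M theta a) (rate M theta' a) s.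
Proof.
move=> equiv V0.
(* The diagonal rate is minus the sum of the others, so the generator acts through increments; this
   serves for both [W = ln V] and [W = V]. *)
have gE vartheta (W : S -> R) : \sum_s' policy_generator M pi vartheta s s' * W s' =
    \sum_(a in avail M s) pi s a *
      \sum_(s' | s' != s) rate M vartheta a s s' * (W s' - W s).
  under eq_bigr do rewrite mulr_suml.
  rewrite exchange_big/=; apply: eq_bigr => a aA.
  rewrite mulr_sumr (bigD1 s)//= rate_diag// mulrN mulNr mulr_sumr mulr_suml.
  rewrite addrC -sumrB; apply: eq_bigr => s' _; ring.
rewrite !gE mulr_suml -big_split/=; apply: ler_sum => a aA.
rewrite -mulrA -mulrDr ler_wpM2l// mulr_suml /ell -big_split/=.
apply: ler_sum => s' s's.
have y0 : 0 < V s' / V s by rewrite divr_gt0.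
have := mulr_ln_le (rate_ge0 theta aA s's) (rate_ge0 theta' aA s's)
  (equiv theta' s s' a aA).1 y0.
rewrite ln_div ?posrE// => /le_trans; apply; rewrite le_eqVlt; apply/orP; left; apply/eqP.
by field; exact: lt0r_neq0.
Qed.

Lemma policy_reward_gt0 vartheta s :
  0 < \sum_(a in avail M s) pi s a * reward M vartheta s a /\
  \sum_(a in avail M s) pi s a * ln (reward M vartheta s a) <=
  ln (\sum_(a in avail M s) pi s a * reward M vartheta s a).
Proof. by apply: sum_ln_le => // a _; exact: reward_gt0. Qed.

Lemma cost_variational (r tau : R) theta theta' s : 0 < tau ->
  \sum_(a in avail M s) pi s a * cost M r theta theta' s a <=
  tau * KL M pi mu s +
  tau * ln (\sum_(a in avail M s) mu s a * expR (cost M r theta theta' s a / tau)).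
Proof.
by move=> tau0; apply: gibbs_variational => // a aA; rewrite mu_ref.2.
Qed.

(** The pointwise form of the bound, to be averaged under the baseline occupancy. The perturbed
    log-reward inside the cost cancels against Jensen's lower bound for the log of the averaged
    reward. *)
Lemma ln_value_drift (r tau : R) (theta theta' : Theta) (V : S -> R) s :
  0 < r -> 0 < tau -> equivalent_rates M theta -> (forall s, 0 < V s) ->
  r * V s = \sum_(a in avail M s) pi s a * reward M theta' s a +
    \sum_s' policy_generator M pi theta' s s' * V s' ->
  \sum_(a in avail M s) pi s a * (r * ln (reward M theta s a)) - tau * KL M pi mu s -
  tau * ln (\sum_(a in avail M s) mu s a * expR (cost M r theta theta' s a / tau)) -
  r * ln r <=
  r * ln (V s) - \sum_s' policy_generator M pi theta s s' * ln (V s').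
Proof.
move=> r0 tau0 equiv V0 VE.
have [] := policy_reward_gt0 theta' s.
set f := (\sum_(a in _) _) in VE *; set lf := (\sum_(a in _) _ * ln _) => f0 lflf.
have Vs := V0 s.
have QV : (\sum_s' policy_generator M pi theta' s s' * V s') / V s = r - f / V s.
  have -> : \sum_s' policy_generator M pi theta' s s' * V s' = r * V s - f by rewrite VE; ring.
  by field; exact: lt0r_neq0.
have := generator_ln_le theta' s equiv V0; rewrite QV.
have := cost_variational r theta theta' s tau0.
have -> : \sum_(a in avail M s) pi s a * cost M r theta theta' s a =
  \sum_(a in avail M s) pi s a * ell (rate M theta a) (rate M theta' a) s -
  r * lf + \sum_(a in avail M s) pi s a * (r * ln (reward M theta s a)).
  rewrite mulr_sumr -sumrB -big_split/=; apply: eq_bigr => a aA.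
  rewrite /cost ln_div ?posrE ?reward_gt0//; ring.
(* The tangent inequality at [f / (r * V s)]; the [ln r] of the theorem originates here. *)
have : ln f - ln r - ln (V s) <= f / (r * V s) - 1.
  have rV : 0 < r * V s by rewrite mulr_gt0.
  have := ln_le_subr1 (divr_gt0 f0 rV); rewrite ln_div ?posrE// lnM ?posrE//; lra.
move=> /(ler_wpM2l (ltW r0)).
have -> : r * (f / (r * V s) - 1) = f / V s - r by field; rewrite !lt0r_neq0.
have := ler_wpM2l (ltW r0) lflf.
lra.
Qed.

(** The two laws are linked through [rho]: the perturbed forward equation is tested against [V], the
    baseline one against [ln V]. Positivity is included so that the logarithm can later be
    inverted. *)
Lemma ln_total_reward_ge (r tau : R) (theta theta' : Theta) (rho D D' : S -> R) :
  0 < r -> 0 < tau -> equivalent_rates M theta -> is_distr rho ->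
  (forall s, 0 <= D s) ->
  (forall s, r * D s = rho s + \sum_x D x * policy_generator M pi theta x s) ->
  (forall s, r * D' s = rho s + \sum_x D' x * policy_generator M pi theta' x s) ->
  let f s := \sum_(a in avail M s) pi s a * reward M theta' s a in
  0 < \sum_s f s * D' s /\
  \sum_s (\sum_(a in avail M s) pi s a * (r * ln (reward M theta s a)) -
           tau * KL M pi mu s) * D s -
  \sum_s D s * (tau * ln (\sum_(a in avail M s)
     mu s a * expR (cost M r theta theta' s a / tau))) - ln r <=
  ln (\sum_s f s * D' s).
Proof.
move=> r0 tau0 equiv [rho0 rho1] D0 DE D'E f.
(* Duality: [E] solves the transposed resolvent equation with source [rho]. *)
have pairing vartheta (E W : S -> R) :
    (forall s, r * E s = rho s + \sum_x E x * policy_generator M pi vartheta x s) ->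
    \sum_s rho s * W s = \sum_s E s *
      (r * W s - \sum_s' policy_generator M pi vartheta s s' * W s').
  move=> EE.
  have -> : \sum_s rho s * W s =
      \sum_s r * E s * W s - \sum_s \sum_x E x * policy_generator M pi vartheta x s * W s.
    rewrite -sumrB; apply: eq_bigr => s _; rewrite EE mulrDl mulr_suml; ring.
  rewrite exchange_big/= -sumrB; apply: eq_bigr => s _.
  rewrite mulrBr mulr_sumr; congr (_ - _); first ring.
  by apply: eq_bigr => s' _; rewrite mulrA.
have [V VE] := resolvent_ex (policy_generator_ge0 theta') (policy_generator_sum0 theta') r0 f.
(* The averaged reward has a positive minimum over the finite state space, and the minimum principle
   passes it to [V]. *)
have V0 s : 0 < V s.
  have [s0 _ s0min] := @arg_minP _ _ _ s xpredT f isT.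
  rewrite -(pmulr_rgt0 _ r0).
  have := resolvent_minimum (policy_generator_ge0 theta') (policy_generator_sum0 theta')
    r0 VE (fun x => s0min x isT) s.
  exact/lt_le_trans/(policy_reward_gt0 theta' s0).1.
have fV : \sum_s f s * D' s = \sum_s rho s * V s.
  rewrite (pairing _ _ V D'E); apply: eq_bigr => s _; rewrite VE; ring.
have [rV0 rVln] := sum_ln_le (A := xpredT) (fun s _ => rho0 s) rho1 (fun s _ => V0 s).
rewrite fV; split => //; apply: le_trans rVln.
(* Testing against the constant [1] gives the total mass, which spreads the term [ln r] over the
   states. *)
have D1 : r * \sum_s D s = 1.
  have := pairing theta D (fun=> 1) DE.
  under eq_bigr do rewrite mulr1.
  rewrite rho1 mulr_sumr => ->; apply: eq_bigr => s _.
  under eq_bigr do rewrite mulr1.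
  by rewrite policy_generator_sum0; ring.
rewrite (pairing _ _ (fun s => ln (V s)) DE).
rewrite -[ln r]mul1r -D1 mulr_sumr mulr_suml -!sumrB; apply: ler_sum => s _.
apply: le_trans (ler_wpM2l (D0 s) (ln_value_drift r0 tau0 equiv V0 (VE s))).
rewrite le_eqVlt; apply/orP; left; apply/eqP; rewrite /f; ring.
Qed.

End robustness.

Theorem theorem3p6 (R : realType) (S A : finType) (Theta : Type)
  (M : ctmdp R S A Theta) (theta : Theta)
  (rho : S -> R) (rho_distr : is_distr rho)
  (r : R) (r_gt0 : 0 < r)
  (mu : S -> A -> R) (mu_ref : is_reference_policy M mu)
  (d : measure_display) (Omega : measurableType d)
  (X : R -> Omega -> S)
  (P : (S -> A -> R) -> Theta -> probability Omega R)
  (P_chain : forall (pi : S -> A -> R) (vartheta : Theta), is_policy M pi ->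
    markov_chain (P pi vartheta) X rho (policy_generator M pi vartheta))
  (rates_equiv : equivalent_rates M theta) :
  forall (tau : R) (pi : S -> A -> R) (eps : R),
    0 < tau -> is_policy M pi -> 0 <= eps ->
    ((expR
        (fine (discounted_expectation (P pi theta) r X
           (fun s => (\sum_(a in avail M s) pi s a * (r * ln (reward M theta s a))
                      - tau * KL M pi mu s)%R))
         - eps / r - ln r))%:E
     <=
     ereal_inf
       [set discounted_expectation (P pi theta') r X
              (fun s => (\sum_(a in avail M s) pi s a * reward M theta' s a)%R)
       | theta' in uncertainty_set M r mu (occupancy (P pi theta) r X)
                     tau eps theta])%E.
Proof.
move=> tau pi eps tau0 pi_policy eps0.
apply: le_ereal_inf_tmp => _ /= [theta' theta'_in <-].
have [D [ED occD D0 DE]] := markov_chain_occupancy rho_distr r_gt0 (P_chain _ theta pi_policy).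
have [D' [ED' _ _ D'E]] := markov_chain_occupancy rho_distr r_gt0 (P_chain _ theta' pi_policy).
have [+ value_ge] := ln_total_reward_ge pi_policy mu_ref r_gt0 tau0 rates_equiv rho_distr D0 DE D'E.
rewrite ED' lee_fin ED/= => value_gt0.
rewrite -[leRHS]lnK ?posrE// ler_expR; apply: le_trans value_ge.
(* What remains is the constraint defining the uncertainty set; it is weighted by the occupancy
   [r * D s], whence [eps / r]. *)
rewrite lerD2r lerD2l lerN2 ler_pdivlMr// mulrC mulr_sumr.
by under eq_bigr do rewrite (mulrA r) -occD.
Qed.
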